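(* Let $T=(T_1,\dots,T_d)$ be a contractive tuple on $H$ with $0<\Delta_T<\infty$. If $\Delta_{T^n}=\Delta_{T^{n+1}}$ for some $n\ge1$, then $\Delta_{T^k}=\Delta_{T^n}$ for all $k\ge n$.
   Context: Fix a positive integer $d$ and a complex, separable, infinite dimensional Hilbert space $H$. A $d$-tuple $T=(T_1,\dots,T_d)$ of bounded operators on $H$ (not assumed to commute) is contractive if $T_1T_1^*+\cdots+T_dT_d^*\le I$. Put $P_T(X)=\sum_{i=1}^d T_iXT_i^*$ for $X\in\mathcal B(H)$, and let $P_T^n$ be the $n$-fold iterate of $P_T$. For $n\ge1$, $T^n$ denotes the $d^n$-tuple of all products $T_{i_1}T_{i_2}\cdots T_{i_n}$, $1\le i_1,\dots,i_n\le d$ (so $P_{T^n}(I)=P_T^n(I)$). The $n$-th defect space is $H_n=\overline{\mathrm{Range}}\,(I-P_T^n(I))$ and the $n$-th defect dimension is $\Delta_{T^n}=\dim H_n$; in particular $\Delta_T=\dim H_1$. *)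

(* Defs.v *)
From HB Require Import structures.
From mathcomp Require Import all_boot all_order all_algebra.
From mathcomp Require Import sesquilinear complex.
From mathcomp Require Import all_classical all_reals all_analysis.

Set Implicit Arguments.
Unset Strict Implicit.
Unset Printing Implicit Defensive.

Import Order.TTheory GRing.Theory Num.Theory Num.Def.
Import numFieldNormedType.Exports.

Local Open Scope classical_set_scope.
Local Open Scope complex_scope.
Local Open Scope ring_scope.

Definition separable (X : topologicalType) : Prop :=
  exists2 D : set X, countable D & dense D.

Section Dimension.
Context {R : realType} {V : lmodType R[i]}.

Definition lin_indep n (e : 'I_n -> V) : Prop :=
  forall c : 'I_n -> R[i], \sum_i c i *: e i = 0 -> forall i, c i = 0.

Definition lin_span n (e : 'I_n -> V) : set V :=
  [set \sum_i c i *: e i | c in [set: 'I_n -> R[i]]].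

Definition is_basis n (W : set V) (e : 'I_n -> V) : Prop :=
  lin_indep e /\ lin_span e = W.

(* The common size of the finite bases of the subspace W, and +oo (the infimum
   of the empty set) if W has no finite basis. In a separable Hilbert space all
   infinite dimensional closed subspaces have the same Hilbert dimension, so a
   single infinite value is enough. *)
Definition dimension (W : set V) : \bar R :=
  ereal_inf [set (n%:R : R)%:E | n in
               [set n | exists e : 'I_n -> V, is_basis W e]].

End Dimension.

Section Operators.
Context {R : realType} {H : completeNormedModType R[i]}.
(* [ip] is linear in its first argument and conjugate-linear in the second. *)
Variable ip : {dot H for @conjC R[i]}.

(* By Riesz representation, for a bounded operator A the set below is a
   singleton for every y, so that the default value 0 is never used. *)
Definition adjoint (A : H -> H) : H -> H :=
  fun y => xget 0 [set z | forall x, ip (A x) y = ip x z].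

(* The order of R[i] is such that 0 <= z iff z is a nonnegative real. *)
Definition op_le (A B : H -> H) : Prop := forall x, 0 <= ip (B x - A x) x.

Variable d : nat.
Implicit Type T : 'I_d -> H -> H.

Definition P_op T (X : H -> H) : H -> H :=
  fun x => \sum_i T i (X (adjoint (T i) x)).

Definition contractive T : Prop :=
  op_le (fun x => \sum_i T i (adjoint (T i) x)) id.

Definition defect_op T n : H -> H := fun x => x - iter n (P_op T) id x.

Definition defect_space T n : set H := closure (range (defect_op T n)).

Definition defect_dim T n : \bar R := dimension (defect_space T n).

End Operators.

(* Main.v *)
Require Import Defs.
From HB Require Import structures.
From mathcomp Require Import all_boot all_order all_algebra.
From mathcomp Require Import sesquilinear complex.
From mathcomp Require Import all_classical all_reals all_analysis.
From mathcomp Require Import ring lra.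

Set Implicit Arguments.
Unset Strict Implicit.
Unset Printing Implicit Defensive.

Import Order.TTheory GRing.Theory Num.Theory Num.Def.
Import numFieldNormedType.Exports.

Local Open Scope classical_set_scope.
Local Open Scope complex_scope.
Local Open Scope ring_scope.

(** Put [D_n = I - P_T^n(I)], so that the n-th defect space is the closure of
    the range of [D_n]. Everything follows from the recursion

      [D_{n+1} = D_1 + sum_i T_i D_n T_i^*]      ([defect_opS]).

    By induction each [D_n] is self-adjoint and positive, the positivity of
    [D_1] being contractivity. A sum of positive operators kills a vector only
    if each summand does, because a positive operator annihilates every vector
    on which its quadratic form vanishes ([psd_form_eq0]). Hence

      [ker D_{n+1} = ker D_1 /\ {x | T_i^* x in ker D_n for all i}]
                                                 ([defect_kerS]).

    So [ker D_{n+1}] is a fixed function of [ker D_n]: the kernels decrease,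
    and once two consecutive ones agree they are constant from then on
    ([defect_ker_anti], [defect_ker_stable]).

    It remains to pass between kernels and dimensions. The recursion also shows
    that every [D_n] has finite rank when [D_1] has. The range of a finite rank
    operator is closed ([closure_basis], by orthogonal projection) and is
    isomorphic to the quotient of the space by the kernel. Thus equal kernels
    give equal defect dimensions ([defect_dim_of_ker]); conversely, as
    [ker D_{n+1}] is contained in [ker D_n], equal finite defect dimensions
    force the two kernels to coincide ([defect_ker_of_dim_eq]).

    The identities above use that the chosen value [adjoint ip (T i) y] does
    represent the functional [x |-> <T_i x, y>] ([adjointP]). This is the Riesz
    representation theorem ([riesz]), proved here by minimizing
    [|x|^2 - 2 Re f(x)] over the complete space. *)

(** * Finite families, bases and ranks *)

Section LinearAlgebra.
Context {R : realType} {V : lmodType R[i]}.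
Implicit Types W : set V.

Definition subspace W : Prop :=
  W 0 /\ forall (a : R[i]) u v, W u -> W v -> W (a *: u + v).

Lemma subspace_sum W (I : finType) (c : I -> R[i]) (e : I -> V) :
  subspace W -> (forall i, W (e i)) -> W (\sum_i c i *: e i).
Proof.
move=> [W0 WL] We; elim/big_rec: _ => // i x _ Wx; exact: WL.
Qed.

(** Lets a spanning family be indexed by whatever finite type arises naturally;
    the recursion for the ranges of defect operators needs a sum of products
    of ordinals. *)
Lemma lin_span_reindex W (I : finType) (e : I -> V) :
  (forall w, W w -> exists c : I -> R[i], w = \sum_i c i *: e i) ->
  exists m, exists f : 'I_m -> V, W `<=` lin_span f.
Proof.
move=> We; exists #|I|, (fun k => e (enum_val k)) => w /We[c ->].
exists (fun k => c (enum_val k)) => //.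
by rewrite (reindex (@enum_val I predT)) //; apply/onW_bij/enum_val_bij.
Qed.

(** If [m > n], the matrix of the coordinates of [e] on [f] has more rows than
    columns; a vector in its row kernel is a nontrivial relation between the
    [e i]. *)
Lemma lin_indep_le_span m n (e : 'I_m -> V) (f : 'I_n -> V) :
  lin_indep e -> (forall i, lin_span f (e i)) -> (m <= n)%N.
Proof.
move=> eI ef; rewrite leqNgt; apply/negP => n_lt_m.
have /choice[c cE] : forall i, exists c : 'I_n -> R[i], \sum_j c j *: f j = e i.
  by move=> i; have [c _ <-] := ef i; exists c.
pose A : 'M[R[i]]_(m, n) := \matrix_(i, j) c i j.
have /rowV0Pn[v /sub_kermxP vA v0] : kermx A != 0.
  rewrite -mxrank_eq0 mxrank_ker subn_eq0 -ltnNge.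
  exact: leq_ltn_trans (rank_leq_col A) _.
case/negP: v0; apply/eqP/rowP => i; rewrite mxE.
apply: (eI (fun i => v 0 i)).
under eq_bigr => k _ do rewrite -cE scaler_sumr.
rewrite exchange_big big1 //= => j _.
under eq_bigr => k _ do rewrite scalerA.
rewrite -scaler_suml.
have /rowP/(_ j) := vA; rewrite !mxE; under eq_bigr => k _ do rewrite mxE.
by move=> ->; rewrite scale0r.
Qed.

Definition fcons m (v : V) (e : 'I_m -> V) : 'I_m.+1 -> V :=
  fun i => if unlift ord0 i is Some j then e j else v.

Lemma lin_indep_cons m (v : V) (e : 'I_m -> V) :
  lin_indep e -> ~ lin_span e v -> lin_indep (fcons v e).
Proof.
move=> eI vNe c; rewrite big_ord_recl {1}/fcons unlift_none.
under eq_bigr => i _ do rewrite /fcons liftK.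
move=> cv0.
have c0 : c ord0 = 0.
  apply/eqP/negPn/negP => c0; apply: vNe.
  exists (fun i => - ((c ord0)^-1 * c (lift ord0 i))) => //.
  under eq_bigr => i _ do rewrite scaleNr -scalerA.
  rewrite sumrN -scaler_sumr; move/eqP: cv0; rewrite addrC addr_eq0 => /eqP ->.
  by rewrite scalerN opprK scalerA mulVf // scale1r.
move: cv0; rewrite c0 scale0r add0r => /eI ce i.
by case: (unliftP ord0 i) => [j ->|->].
Qed.

(** A vector outside the span could be added to [e], giving an independent
    family of more than [n] vectors in the span of [f]. *)
Lemma lin_indep_spans m n W (e : 'I_m -> V) (f : 'I_n -> V) :
  W `<=` lin_span f -> (n <= m)%N -> lin_indep e -> (forall i, W (e i)) ->
  W `<=` lin_span e.
Proof.
move=> Wf nm eI We v Wv; apply: contrapT => ve.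
have := lin_indep_le_span (f := f) (lin_indep_cons eI ve).
rewrite ltnNge nm => /(_ _)/negP/=[]//.
by move=> i; apply: Wf; rewrite /fcons; case: unlift.
Qed.

(** An independent family in [W] of maximal size is a basis; sizes are bounded
    by [n]. *)
Lemma subspace_basis n W (f : 'I_n -> V) :
  subspace W -> W `<=` lin_span f -> exists m (e : 'I_m -> V), is_basis W e.
Proof.
move=> Ws Wf.
pose P m := `[< exists e : 'I_m -> V, lin_indep e /\ forall i, W (e i) >].
have P0 : exists m, P m.
  by exists 0; apply/asboolP; exists (fun=> 0); split => [c _|] [].
have Pn m : P m -> (m <= n)%N.
  move=> /asboolP[e [eI We]]; apply: lin_indep_le_span eI _ => i.
  exact/Wf/We.
case: (ex_maxnP P0 Pn) => m /asboolP[e [eI We]] mmax.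
exists m, e; split=> //; apply/seteqP; split=> [_ [c _ <-]|v Wv].
  exact: subspace_sum.
apply: contrapT => ve.
have /mmax : P m.+1.
  apply/asboolP; exists (fcons v e); split; first exact: lin_indep_cons.
  by move=> i; rewrite /fcons; case: unlift.
by rewrite ltnn.
Qed.

(** All bases of [W] have the same size, so the infimum defining the dimension
    is over a singleton. *)
Lemma dimension_basis n W (e : 'I_n -> V) :
  is_basis W e -> dimension W = (n%:R : R)%:E.
Proof.
move=> eW; rewrite /dimension.
suff -> : [set m | exists f : 'I_m -> V, is_basis W f] = [set n].
  by rewrite image_set1 ereal_inf1.
have le m p (f : 'I_m -> V) (g : 'I_p -> V) :
    is_basis W f -> is_basis W g -> (m <= p)%N.
  move=> [fI fW] [_ gW]; apply: (lin_indep_le_span (f := g)) fI _ => i.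
  rewrite gW -fW; exists (fun j => (j == i)%:R) => //.
  rewrite (bigD1 i) //= eqxx scale1r big1 ?addr0 // => j /negPf ->.
  exact: scale0r.
apply/seteqP; split=> [m [f fW]|_ ->]; last by exists e.
by apply/eqP; rewrite eqn_leq (le _ _ _ _ fW eW) (le _ _ _ _ eW fW).
Qed.

Lemma dimension_lty W : (dimension W < +oo)%E ->
  exists n (e : 'I_n -> V), is_basis W e.
Proof. by move=> /ereal_inf_lt[_ [n [e eW] <-] _]; exists n, e. Qed.

Lemma range_subspace (A : {linear V -> V}) : subspace (range A).
Proof.
split=> [|a _ _ [u _ <-] [v _ <-]]; first by exists 0; rewrite ?linear0.
by exists (a *: u + v); rewrite ?linearP.
Qed.

Lemma linear_lincomb (A : {linear V -> V}) m (c : 'I_m -> R[i]) (x : 'I_m -> V) :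
  A (\sum_j c j *: x j) = \sum_j c j *: A (x j).
Proof. by rewrite linear_sum; apply: eq_bigr => j _; rewrite linearZ. Qed.

Lemma lin_indep_preimage (A B : {linear V -> V}) m (x : 'I_m -> V) :
  (forall v, A v = 0 -> B v = 0) ->
  lin_indep (fun j => B (x j)) -> lin_indep (fun j => A (x j)).
Proof.
move=> AB xI c; rewrite -linear_lincomb => /AB.
by rewrite linear_lincomb => /xI.
Qed.

Lemma range_family (A : {linear V -> V}) m (e : 'I_m -> V) :
  is_basis (range A) e -> exists x : 'I_m -> V, is_basis (range A) (fun j => A (x j)).
Proof.
move=> [eI eA]; have /choice[x xE] : forall j, exists x, A x = e j.
  move=> j; have [x _ <-] : range A (e j); last by exists x.
  rewrite -eA; exists (fun i => (i == j)%:R) => //.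
  rewrite (bigD1 j) //= eqxx scale1r big1 ?addr0 // => i /negPf ->.
  exact: scale0r.
by exists x; have -> : (fun j => A (x j)) = e by apply/funext.
Qed.

(** [A x |-> B x] is a well-defined surjection from the range of [A] onto the
    range of [B]; between spaces of the same finite dimension it is injective.
    Concretely, lift a basis of the range of [B] to vectors [x j]: the
    [A (x j)] are independent, so by counting they span the range of [A]. *)
Lemma ker_eq_of_range_dim (A B : {linear V -> V}) m (e f : 'I_m -> V) :
  is_basis (range A) e -> is_basis (range B) f ->
  (forall v, A v = 0 -> B v = 0) -> forall v, B v = 0 -> A v = 0.
Proof.
move=> [_ eA] /range_family[x [xI xB]] AB v Bv.
have [c _ cE] : lin_span (fun j => A (x j)) (A v).
  apply: (lin_indep_spans (W := range A) (f := e)) => //.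
    by rewrite eA.
  exact: lin_indep_preimage AB xI.
have Bc : \sum_j c j *: B (x j) = 0.
  rewrite -linear_lincomb -[LHS](subrK (B v)) -linearB Bv addr0; apply: AB.
  by rewrite linearB linear_lincomb cE subrr.
by rewrite -cE big1 // => j _; rewrite (xI _ Bc) scale0r.
Qed.

(** Both ranges are isomorphic to the quotient by the common kernel. *)
Lemma range_basis_of_ker (A B : {linear V -> V}) m (e : 'I_m -> V) :
  (forall v, A v = 0 <-> B v = 0) -> is_basis (range A) e ->
  exists f : 'I_m -> V, is_basis (range B) f.
Proof.
move=> AB /range_family[x [xI xA]]; exists (fun j => B (x j)); split.
  by apply: lin_indep_preimage xI => v /AB.
apply/seteqP; split=> [_ [c _ <-]|_ [v _ <-]].
  by exists (\sum_j c j *: x j); rewrite ?linear_lincomb.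
have [c _ cE] : lin_span (fun j => A (x j)) (A v) by rewrite xA; exists v.
exists c => //; apply/eqP; rewrite -linear_lincomb eq_sym -subr_eq0 -linearB.
by apply/eqP/AB; rewrite linearB linear_lincomb cE subrr.
Qed.

End LinearAlgebra.

(** * The real inner product and the Riesz representation *)

(** The first order condition for a minimum at 0, without derivatives: at
    [t = - g / (|c| + 1)] the linear term dominates. *)
Lemma quadratic_ge0_lin0 (R : realType) (g c : R) :
  (forall t, 0 <= t ^+ 2 * c + t * g) -> g = 0.
Proof.
move=> h; apply/eqP/negPn/negP => g0.
have g2 : 0 < g ^+ 2 by rewrite exprn_even_gt0.
have c1 : 0 < `|c| + 1 by rewrite ltr_wpDl.
have := h (- g / (`|c| + 1)).
have -> : (- g / (`|c| + 1)) ^+ 2 * c + - g / (`|c| + 1) * g =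
          g ^+ 2 * ((c - (`|c| + 1)) / (`|c| + 1) ^+ 2).
  by field; rewrite gt_eqF.
rewrite pmulr_rge0 // pmulr_lge0 ?invr_gt0 ?exprn_gt0 // subr_ge0 leNgt.
by rewrite (le_lt_trans (ler_norm c)) // ltrDl.
Qed.

Section InnerProduct.
Context {R : realType} {H : completeNormedModType R[i]}.
Variable ip : {dot H for @conjC R[i]}.
Hypothesis ip_norm : forall x : H, ip x x = `|x| ^+ 2.

Lemma ipC x y : ip y x = conjC (ip x y).
Proof. by rewrite hermC expr0 mul1r. Qed.

Lemma ipZr (a : R[i]) x y : ip x (a *: y) = conjC a * ip x y.
Proof. by rewrite linearZr. Qed.

(** The order, the infimum and the arithmetic of the estimates take place in
    [R], so the underlying real Hilbert space structure is used for them. *)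
Definition rip (x y : H) : R := complex.Re (ip x y).

Lemma ripC x y : rip x y = rip y x.
Proof. by rewrite /rip ipC; case: (ip y x). Qed.

Lemma ripDl x y z : rip (x + y) z = rip x z + rip y z.
Proof. by rewrite /rip linearDl raddfD. Qed.

Lemma ripDr x y z : rip z (x + y) = rip z x + rip z y.
Proof. by rewrite ripC ripDl !(ripC z). Qed.

Lemma ReZ (t : R) (w : R[i]) : complex.Re (t%:C * w) = t * complex.Re w.
Proof. by case: w => a b /=; rewrite mul0r subr0. Qed.

Lemma ripZl (t : R) x y : rip (t%:C *: x) y = t * rip x y.
Proof. by rewrite /rip linearZl_LR ReZ. Qed.

Lemma ripZr (t : R) x y : rip x (t%:C *: y) = t * rip x y.
Proof. by rewrite ripC ripZl ripC. Qed.

Lemma ripNl x y : rip (- x) y = - rip x y.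
Proof. by rewrite /rip linearNl raddfN. Qed.

Lemma ripNr x y : rip x (- y) = - rip x y.
Proof. by rewrite ripC ripNl ripC. Qed.

Lemma normcE (x : H) : `|x| = (complex.Re `|x|)%:C.
Proof. by rewrite RRe_real // ger0_real. Qed.

Lemma rip_norm x : rip x x = complex.Re `|x| ^+ 2.
Proof.
by rewrite /rip ip_norm [in LHS]normcE expr2 ReZ.
Qed.

Lemma rip_ge0 x : 0 <= rip x x.
Proof. by rewrite rip_norm sqr_ge0. Qed.

Lemma Re_norm_ge0 (x : H) : 0 <= complex.Re `|x|.
Proof. by rewrite -lecR -normcE rmorph0 normr_ge0. Qed.

Lemma norm_lt_rip (x : H) (e : R) : 0 < e -> rip x x < e ^+ 2 -> `|x| < e%:C.
Proof.
move=> e0; rewrite rip_norm normcE ltcR.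
by rewrite ltr_pXn2r // nnegrE ?Re_norm_ge0 // ltW.
Qed.

Lemma rip_lt_norm (x : H) (e : R) : `|x| < e%:C -> rip x x < e ^+ 2.
Proof.
rewrite rip_norm normcE ltcR => xe.
rewrite ltr_pXn2r // nnegrE ?Re_norm_ge0 // ltW //.
exact: le_lt_trans (Re_norm_ge0 x) xe.
Qed.

Lemma rip_eq0 x : rip x x = 0 -> x = 0.
Proof.
move/eqP; rewrite rip_norm sqrf_eq0 => /eqP x0.
by apply/eqP; rewrite -normr_eq0 normcE x0.
Qed.

Lemma ip_inj u v : (forall x, ip x u = ip x v) -> u = v.
Proof.
move=> uv; apply/eqP; rewrite -subr_eq0; apply/eqP/rip_eq0.
by rewrite /rip linearBr /= uv subrr.
Qed.

Section Riesz.
Variable f : H -> R[i].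
Hypothesis f_lin : scalar f.
Let J x : R := rip x x - complex.Re (f x) *+ 2.
Variable c : R.
Hypothesis J_ge : forall x, c <= J x.

Let fD x y : f (x + y) = f x + f y.
Proof. by rewrite -[x in LHS]scale1r f_lin mul1r. Qed.

Let f0 : f 0 = 0.
Proof. by apply: (addrI (f 0)); rewrite -fD !addr0. Qed.

Let fZ a x : f (a *: x) = a * f x.
Proof. by rewrite -[a *: x]addr0 f_lin f0 addr0. Qed.

Let m := inf (range J).

Let J_inf : has_inf (range J).
Proof.
split; first by exists (J 0), 0.
by exists c => _ [x _ <-].
Qed.

Let m_le x : m <= J x.
Proof. by apply: ge_inf; [case: J_inf|exists x]. Qed.

Let near_min (e : R) := [set x | J x < m + e].

(* The parallelogram identity, with [J] at the midpoint at least [m]. *)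
Let J_near_min_close (e : R) x y :
  J x < m + e -> J y < m + e -> rip (x - y) (x - y) < 4 * e.
Proof.
move=> Jx Jy; have := m_le ((2^-1)%:C *: (x + y)); move: Jx Jy; rewrite /J.
rewrite fZ fD ReZ raddfD /= !(ripDl, ripDr, ripZl, ripZr, ripNl, ripNr) (ripC y x).
lra.
Qed.

Let near_min_filter : ProperFilter (filter_from [set e | 0 < e] near_min).
Proof.
apply: filter_from_proper.
  apply: filter_from_filter; first by exists 1 => /=.
  move=> i j i0 j0; exists (Num.min i j); first by rewrite /= lt_min i0.
  by move=> x; rewrite /near_min /= => xm; split; apply: (lt_le_trans xm);
    rewrite lerD2l ge_min lexx ?orbT.
move=> e e0; have [_ [x _ <-] xm] := inf_adherent e0 J_inf.
by exists x.
Qed.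

(* Sets of near minimizers form a Cauchy filter; completeness of the space
   yields its limit. Only the existence of near minimizers arbitrarily close
   to the limit is kept, which avoids continuity of [J]. *)
Let minimizer : exists z, forall e : R, 0 < e ->
  exists2 x, J x < m + e & rip (x - z) (x - z) < e ^+ 2.
Proof.
have PF := near_min_filter.
have : cvg (filter_from [set e : R | 0 < e] near_min).
  apply/cauchy_cvgP/cauchy_exP => eps eps0.
  pose e := complex.Re eps.
  have epsE : eps = e%:C by rewrite RRe_real // gtr0_real.
  have e0 : 0 < e by rewrite -ltcR -epsE.
  have d0 : 0 < e ^+ 2 / 4 by rewrite divr_gt0 // exprn_gt0.
  have [_ [x _ <-] xm] := inf_adherent d0 J_inf.
  exists x; exists (e ^+ 2 / 4) => // y ym.
  rewrite -ball_normE /= epsE; apply: norm_lt_rip => //.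
  apply: lt_le_trans (J_near_min_close xm ym) _.
  by rewrite mulrC divfK.
move=> /cvg_ex[z Fz]; exists z => e e0.
have /Fz[d d0 dz] : nbhs z (ball z e%:C).
  by apply: nbhsx_ballx; rewrite ltcR.
have de0 : 0 < Num.min d e by rewrite lt_min d0.
have [_ [x _ <-] xm] := inf_adherent de0 J_inf.
exists x; first by apply: (lt_le_trans xm); rewrite lerD2l ge_min lexx orbT.
have /dz : near_min d x.
  by apply: (lt_le_trans xm); rewrite lerD2l ge_min lexx.
by rewrite -ball_normE /= distrC => /rip_lt_norm.
Qed.

(** At the minimizer [z] the variation of [J] in every real direction vanishes,
    which says [Re (f h) = Re <h, z>] for all [h]; applying this to ['i *: h]
    gives the equality of the imaginary parts. The lower bound on [J] is how
    boundedness of [f] enters. *)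
Lemma riesz : exists z, forall x, f x = ip x z.
Proof.
have [z zP] := minimizer; exists z.
have stat h : 0 <= rip h h + (rip h z - complex.Re (f h)) *+ 2.
  apply/ler_addgt0Pl => e e0; rewrite addrC.
  (* Passing from [x] to [z] costs [2 Re <x - z, h> <= d (1 + |h|^2)], and [x]
     misses the minimum by at most [d]; [d] makes the total equal to [e]. *)
  pose d := e / (2 + rip h h).
  have den : 0 < 2 + rip h h by rewrite ltr_pwDl ?rip_ge0.
  have d0 : 0 < d by rewrite divr_gt0.
  have [x xm xz] := zP _ d0.
  have eE : e = d * (2 + rip h h) by rewrite divfK // gt_eqF.
  have := m_le (x + h).
  have [u xE] : exists u, x = u + z by exists (x - z); rewrite subrK.
  move: xz; rewrite xE addrK => xz.
  have : d * (rip u h *+ 2) <= d * (d * (1 + rip h h)).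
    have := rip_ge0 (u - d%:C *: h).
    rewrite !(ripDl, ripDr, ripZl, ripZr, ripNl, ripNr) (ripC h u).
    by move: xz; lra.
  rewrite ler_pM2l // => uh; move: xm; rewrite /J xE fD fD raddfD /=.
  rewrite !(ripDl, ripDr) (ripC h u) (ripC z u) (ripC h z) eE; lra.
have re0 h : rip h z = complex.Re (f h).
  apply/eqP; rewrite -subr_eq0; apply/eqP.
  apply: (mulIf (x := 2)); rewrite ?mul0r //.
  apply: (@quadratic_ge0_lin0 _ _ (rip h h)) => t.
  have := stat (t%:C *: h); rewrite fZ ReZ ripZl ripZl ripZr; lra.
move=> h; have := re0 h; have := re0 ('i%C *: h).
rewrite /rip fZ linearZl_LR /=.
case: (f h) (ip h z) => a b [a' b'] /=; rewrite !(mul0r, mul1r, sub0r).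
by move=> /oppr_inj -> ->.
Qed.

End Riesz.

Lemma bounded_near_op (A : {linear H -> H}) :
  bounded_near A (nbhs (0 : H)) -> exists K : R, 0 < K /\
    forall x, rip (A x) (A x) <= K * rip x x.
Proof.
move=> /linear_boundedP/pinfty_ex_gt0[r r0 rA].
have rE : r = (complex.Re r)%:C by rewrite RRe_real // gtr0_real.
have k0 : 0 < complex.Re r by rewrite -ltcR -rE.
exists (complex.Re r ^+ 2); split=> [|x]; first exact: exprn_gt0.
rewrite !rip_norm -exprMn ler_pXn2r ?nnegrE ?mulr_ge0 ?Re_norm_ge0 ?(ltW k0) //.
by have := rA x; rewrite (normcE (A x)) (normcE x) rE -rmorphM lecR.
Qed.

(** Riesz applied to [u |-> <A u, y>]. If [|A u|^2 <= K |u|^2], expanding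
    [|A u - K y|^2 >= 0] bounds [|u|^2 - 2 Re <A u, y>] below by [- K |y|^2]. *)
Lemma adjointP (A : {linear H -> H}) x y :
  bounded_near A (nbhs (0 : H)) -> ip (A x) y = ip x (adjoint ip A y).
Proof.
move=> /bounded_near_op[K [K0 AK]].
have : exists z, forall x, ip (A x) y = ip x z.
  apply: (@riesz _ _ (- (K * rip y y))) => [a u v|u].
    by rewrite linearP linearDl linearZl_LR.
  have := rip_ge0 (A u - K%:C *: y); have := AK u.
  rewrite !(ripDl, ripDr, ripZl, ripZr, ripNl, ripNr) (ripC y) -/(rip _ _).
  by move=> Au Ay; rewrite -(ler_pM2l K0); lra.
move=> [z zP]; have := xgetPex 0 (P := [set z | forall x, ip (A x) y = ip x z]).
by move=> /(_ (ex_intro _ z zP)); apply.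
Qed.

End InnerProduct.

(** * Finite dimensional subspaces are closed *)

Section ClosedSubspace.
Context {R : realType} {H : completeNormedModType R[i]}.
Variable ip : {dot H for @conjC R[i]}.
Hypothesis ip_norm : forall x : H, ip x x = `|x| ^+ 2.

(** The coordinates of the projection solve a linear system whose matrix is the
    Gram matrix of [e], invertible because [e] is independent. *)
Lemma orthogonal_projection m (e : 'I_m -> H) x :
  lin_indep e -> exists2 w, lin_span e w & forall v, lin_span e v -> ip (x - w) v = 0.
Proof.
move=> eI.
pose G : 'M[R[i]]_m := \matrix_(i, j) ip (e i) (e j).
have ipG (v : 'rV_m) j : ip (\sum_i v 0 i *: e i) (e j) = (v *m G) 0 j.
  rewrite linear_sumlz mxE /=; apply: eq_bigr => i _.
  by rewrite linearZl_LR mxE.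
have ip_span u (v : 'I_m -> R[i]) : (forall j, ip u (e j) = 0) ->
    ip u (\sum_j v j *: e j) = 0.
  move=> u0; rewrite linear_sumr big1 //= => j _.
  by rewrite ipZr u0 mulr0.
have Gu : G \in unitmx.
  rewrite -row_free_unit -kermx_eq0; apply/rowV0P => v /sub_kermxP vG.
  apply/rowP => i; rewrite mxE; apply: (eI (fun i => v 0 i)).
  apply: (rip_eq0 ip_norm); rewrite /rip ip_span // => j.
  by rewrite ipG vG mxE.
pose v := (\row_j ip x (e j)) *m invmx G.
exists (\sum_i v 0 i *: e i); first by exists (fun i => v 0 i).
move=> _ [c _ <-]; apply: ip_span => j.
by rewrite linearBl /= ipG mulmxKV // mxE subrr.
Qed.

Lemma rip_pythagoras (u v : H) :
  rip ip u v = 0 -> rip ip (u + v) (u + v) = rip ip u u + rip ip v v.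
Proof. by move=> uv; rewrite ripDl !ripDr (ripC ip v) uv addr0 add0r. Qed.

(** By Pythagoras no point of [W] is closer to [x] than its projection, so a
    point of the closure equals its projection. *)
Lemma closure_basis m W (e : 'I_m -> H) : is_basis W e -> closure W = W.
Proof.
move=> [eI <-]; apply/seteqP; split; last exact: subset_closure.
move=> x xW; have [w we xw] := orthogonal_projection x eI.
suff -> : x = w by [].
apply/eqP/negPn/negP => xNw.
pose r := complex.Re `|x - w|.
have r0 : 0 < r by rewrite -ltcR -normcE normr_gt0 subr_eq0.
have [u [ue]] : lin_span e `&` ball x r%:C !=set0.
  by apply: xW; apply: nbhsx_ballx; rewrite ltcR.
rewrite -ball_normE /= => /(rip_lt_norm ip_norm).
have -> : x - u = (x - w) + (w - u) by rewrite addrA subrK.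
have wu : lin_span e (w - u).
  case: we ue => [c _ <-] [c' _ <-]; exists (fun i => c i - c' i) => //.
  by rewrite -sumrB; apply: eq_bigr => i _; rewrite scalerBl.
have xwu : rip ip (x - w) (w - u) = 0 by rewrite /rip xw.
rewrite (rip_pythagoras xwu) (rip_norm ip_norm (x - w)) -/r.
have := rip_ge0 ip_norm (w - u); lra.
Qed.

(** Moving from [x] in the direction [A x], the form would become negative to
    first order unless [A x = 0]. *)
Lemma psd_form_eq0 (A : {linear H -> H}) x :
  (forall u v, ip (A u) v = ip u (A v)) -> (forall u, 0 <= ip (A u) u) ->
  ip (A x) x = 0 -> A x = 0.
Proof.
move=> Asa A0 Axx; apply: (rip_eq0 ip_norm).
apply: (mulIf (x := 2)); rewrite ?mul0r //.
apply: (@quadratic_ge0_lin0 _ _ (rip ip (A (A x)) (A x))) => t.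
have : 0 <= rip ip (A (x + t%:C *: A x)) (x + t%:C *: A x).
  by have := A0 (x + t%:C *: A x); rewrite lecE => /andP[].
rewrite linearD linearZ /= !(ripDl, ripDr, ripZl, ripZr).
have -> : rip ip (A x) x = 0 by rewrite /rip Axx.
have -> : rip ip (A (A x)) x = rip ip (A x) (A x) by rewrite /rip Asa.
lra.
Qed.

End ClosedSubspace.

(** * Defect operators *)

Section Defect.
Context {R : realType} {H : completeNormedModType R[i]}.
Variable ip : {dot H for @conjC R[i]}.
Hypothesis ip_norm : forall x : H, ip x x = `|x| ^+ 2.
Variables (d : nat) (T : 'I_d -> {linear H -> H}).
Hypothesis T_bounded : forall i, bounded_near (T i) (nbhs (0 : H)).

Local Notation D := (defect_op ip T).

Let ip_adjl i x y : ip (T i x) y = ip x (adjoint ip (T i) y).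
Proof. exact: adjointP. Qed.

Let ip_adjr i x y : ip x (T i y) = ip (adjoint ip (T i) x) y.
Proof. by rewrite ipC ip_adjl -ipC. Qed.

Lemma adjoint_linear i : linear (adjoint ip (T i)).
Proof.
move=> a y z; apply: (ip_inj ip_norm) => x.
by rewrite -ip_adjl !(linearDr, ipZr) /= !(linearDr, ipZr) /= !ip_adjl.
Qed.

(** [I - P(X) = (I - P(I)) + P(I - X)] with [X = P^n(I)]. *)
Lemma defect_opS n x :
  D n.+1 x = D 1 x + \sum_i T i (D n (adjoint ip (T i) x)).
Proof.
rewrite /defect_op iterS /= /P_op -[RHS]addrA; congr (_ + _).
under [X in - _ + X]eq_bigr => i _ do rewrite linearB.
by rewrite sumrB addKr.
Qed.

Lemma defect_op_linear n : linear (D n).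
Proof.
elim: n => [|n IH] a x y.
  by rewrite /defect_op /= !subrr scaler0 addr0.
have P1 : linear (D 1).
  move=> b u v; rewrite /defect_op /= /P_op scalerBr.
  under eq_bigr => i _ do rewrite adjoint_linear linearP.
  by rewrite big_split -scaler_sumr /= opprD addrACA.
rewrite defect_opS P1.
under eq_bigr => i _ do rewrite adjoint_linear IH linearP.
by rewrite big_split -scaler_sumr /= addrACA -scalerDr -!(defect_opS n).
Qed.

HB.instance Definition _ n :=
  GRing.isLinear.Build R[i] H H *:%R (D n) (defect_op_linear n).

Lemma defect_op_selfadjoint n x y : ip (D n x) y = ip x (D n y).
Proof.
elim: n x y => [|n IH] x y.
  by rewrite /defect_op /= !subrr linear0l linear0r.
have P1 : ip (D 1 x) y = ip x (D 1 y).
  rewrite /defect_op /= /P_op linearBl linearBr /=; congr (_ - _).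
  by rewrite linear_sumlz linear_sumr /=; apply: eq_bigr => i _; rewrite ip_adjl ip_adjr.
rewrite !(defect_opS n) linearDl linearDr /= P1; congr (_ + _).
rewrite linear_sumlz linear_sumr /=; apply: eq_bigr => i _.
by rewrite ip_adjl ip_adjr IH.
Qed.

Hypothesis T_contractive : contractive ip T.

Lemma defect_formS n x : ip (D n.+1 x) x =
  ip (D 1 x) x + \sum_i ip (D n (adjoint ip (T i) x)) (adjoint ip (T i) x).
Proof.
rewrite defect_opS linearDl; congr (_ + _); rewrite linear_sumlz /=.
by apply: eq_bigr => i _; rewrite ip_adjl.
Qed.

Lemma defect_op_ge0 n x : 0 <= ip (D n x) x.
Proof.
elim: n x => [|n IH] x; first by rewrite /defect_op /= subrr linear0l.
by rewrite defect_formS addr_ge0 // ?sumr_ge0 //; apply: T_contractive.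
Qed.

(** The form of [D n.+1] at [x] is the sum of the nonnegative terms
    [<D 1 x, x>] and [<D n y_i, y_i>] with [y_i] the image of [x] under the
    adjoint of [T i]; if it vanishes then so do all of these. *)
Lemma defect_kerS n x :
  D n.+1 x = 0 <-> D 1 x = 0 /\ forall i, D n (adjoint ip (T i) x) = 0.
Proof.
split=> [Dx|[D1 Dn]]; last by rewrite defect_opS D1 big1 ?addr0 // => i _; rewrite Dn linear0.
have ker k y : ip (D k y) y = 0 -> D k y = 0.
  apply: (psd_form_eq0 ip_norm); first exact: defect_op_selfadjoint.
  exact: defect_op_ge0.
have /eqP := defect_formS n x; rewrite Dx linear0l eq_sym.
rewrite paddr_eq0 ?defect_op_ge0 ?sumr_ge0 // => [/andP[/eqP D1]|i _]; last exact: defect_op_ge0.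
rewrite psumr_eq0 => [/allP Dn|i _]; last exact: defect_op_ge0.
split=> [|i]; first exact: ker.
by apply: ker; apply/eqP/Dn; rewrite mem_index_enum.
Qed.

Lemma defect_ker_anti n x : D n.+1 x = 0 -> D n x = 0.
Proof.
elim: n x => [|n IH] x; first by rewrite /defect_op /= subrr.
by move=> /defect_kerS[D1 Dn]; apply/defect_kerS; split=> // i; exact: IH.
Qed.

Lemma defect_ker_stable n : (forall x, D n x = 0 -> D n.+1 x = 0) ->
  forall k, (n <= k)%N -> forall x, D n x = 0 <-> D k x = 0.
Proof.
move=> Dn; have step k : (n <= k)%N -> forall x, D k x = 0 -> D k.+1 x = 0.
  elim: k => [|k IH]; first by rewrite leqn0 => /eqP <-.
  rewrite leq_eqVlt => /predU1P[<- //|nk] x /defect_kerS[D1 Dk].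
  by apply/defect_kerS; split=> // i; exact: IH.
elim=> [|k IH]; first by rewrite leqn0 => /eqP ->.
rewrite leq_eqVlt => /predU1P[<- //|nk] x.
by rewrite IH //; split; [exact: step|exact: defect_ker_anti].
Qed.

Hypothesis Delta_fin : (defect_dim ip T 1 < +oo)%E.

(** By the recursion, the range of [D n.+1] lies in the sum of the range of
    [D 1] and of the images under the [T i] of the range of [D n]. *)
Lemma defect_range_fin n :
  exists m (f : 'I_m -> H), range (D n) `<=` lin_span f.
Proof.
elim: n => [|n [p [g gD]]].
  exists 0, (fun=> 0) => _ [x _ <-]; exists (fun=> 0) => //.
  by rewrite big_ord0 /defect_op /= subrr.
have [m [f [_ fD]]] := dimension_lty Delta_fin.
apply: (@lin_span_reindex _ _ _ ('I_m + 'I_d * 'I_p)%type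
  (fun k => match k with inl j => f j | inr ij => T ij.1 (g ij.2) end)).
move=> _ [x _ <-].
have [c _ cE] : lin_span f (D 1 x) by rewrite fD; apply: subset_closure; exists x.
have /choice[c' c'E] : forall i, exists c' : 'I_p -> R[i],
    \sum_j c' j *: g j = D n (adjoint ip (T i) x).
  move=> i; have [|c' _ <-] := gD (D n (adjoint ip (T i) x)); last by exists c'.
  by exists (adjoint ip (T i) x).
exists (fun k => match k with inl j => c j | inr ij => c' ij.1 ij.2 end).
rewrite big_sumType /= cE defect_opS; congr (_ + _).
rewrite -(pair_bigA _ (fun i j => c' i j *: T i (g j))) /=.
apply: eq_bigr => i _; rewrite -c'E linear_sum.
by apply: eq_bigr => j _; rewrite linearZ.
Qed.

Lemma defect_range_basis n : exists m (e : 'I_m -> H), is_basis (range (D n)) e.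
Proof.
have [m [f fD]] := defect_range_fin n.
exact: subspace_basis (range_subspace _) fD.
Qed.

Lemma defect_dim_basis n m (e : 'I_m -> H) :
  is_basis (range (D n)) e -> defect_dim ip T n = (m%:R : R)%:E.
Proof.
move=> eD; rewrite /defect_dim /defect_space (closure_basis ip_norm eD).
exact: dimension_basis eD.
Qed.

Lemma defect_ker_of_dim_eq n : defect_dim ip T n = defect_dim ip T n.+1 ->
  forall x, D n x = 0 -> D n.+1 x = 0.
Proof.
have [m [e eD]] := defect_range_basis n.
have [p [f fD]] := defect_range_basis n.+1.
rewrite (defect_dim_basis eD) (defect_dim_basis fD).
case=> /eqP; rewrite eqr_nat => /eqP mp; subst p.
exact: ker_eq_of_range_dim fD eD (defect_ker_anti (n := n)).
Qed.

Lemma defect_dim_of_ker n k : (forall x, D n x = 0 <-> D k x = 0) ->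
  defect_dim ip T k = defect_dim ip T n.
Proof.
move=> nk; have [m [e eD]] := defect_range_basis n.
have [f fD] := range_basis_of_ker nk eD.
by rewrite (defect_dim_basis eD) (defect_dim_basis fD).
Qed.

End Defect.

Theorem theorem2p4 (R : realType) (H : completeNormedModType R[i])
    (ip : {dot H for @conjC R[i]})
    (ip_norm : forall x : H, ip x x = `|x| ^+ 2)
    (H_separable : separable H)
    (H_infinite_dim : dimension [set: H] = +oo%E)
    (d : nat) (d_gt0 : (0 < d)%N)
    (T : 'I_d -> {linear H -> H})
    (T_bounded : forall i, bounded_near (T i) (nbhs (0 : H)))
    (T_contractive : contractive ip T)
    (Delta_gt0 : (0 < defect_dim ip T 1)%E)
    (Delta_fin : (defect_dim ip T 1 < +oo)%E)
    (n : nat) (n_gt0 : (1 <= n)%N)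
    (Delta_eq : defect_dim ip T n = defect_dim ip T n.+1) :
  forall k : nat, (n <= k)%N -> defect_dim ip T k = defect_dim ip T n.
Proof.
move=> k nk; apply: (defect_dim_of_ker ip_norm T_bounded Delta_fin) => x.
apply: (defect_ker_stable ip_norm T_bounded T_contractive) nk x.
exact: (defect_ker_of_dim_eq ip_norm T_bounded T_contractive Delta_fin).
Qed.
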